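(* Let $d\ge 1$, let $G_1,\ldots,G_d$ be finite simple graphs with vertices among the variables of $R=\mathbb{K}[x_1,\ldots,x_n]$, and let $J_i=I(G_i)\subset R$ be the edge ideal of $G_i$ for $1\le i\le d$. Suppose $J_1\subseteq J_2\subseteq\cdots\subseteq J_d$. Then $$2d+\nu_{G_1\cdots G_d}-1\;\le\;\operatorname{reg}(J_1J_2\cdots J_d),$$ where $\nu_{G_1\cdots G_d}$ is the joint induced matching number of $G_1,\ldots,G_d$.
   Context: $\mathbb{K}$ is a field and $R=\mathbb{K}[x_1,\ldots,x_n]$ is standard graded. All graphs are finite, simple, without isolated vertices, with vertices among $x_1,\ldots,x_n$, and with at least one edge. The edge ideal of $G$ is $I(G)=(x_ix_j \mid \{x_i,x_j\}\in E(G))\subset R$. For a finitely generated graded $R$-module $M$ with graded Betti numbers $\beta_{i,j}(M)$, $\operatorname{reg}(M)=\max\{j-i\mid \beta_{i,j}(M)\ne 0\}$ is the Castelnuovo-Mumford regularity. A matching in a graph is a set of pairwise disjoint edges; it is an induced matching of $G$ if the subgraph of $G$ induced on its endpoints has no edges other than those of the matching. When each $G_i$ is a subgraph of $G_{i+1}$, the joint induced matching number $\nu_{G_1\cdots G_d}$ is the largest size of a set of edges that is an induced matching of $G_i$ for every $1\le i\le d$ simultaneously. *)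

(* Defs.v *)
From HB Require Import structures.
From mathcomp Require Import all_boot all_order all_algebra.
From mathcomp Require Import mpoly.

Set Implicit Arguments.
Unset Strict Implicit.
Unset Printing Implicit Defensive.

Import GRing.Theory.
Local Open Scope ring_scope.

(* The index i : 'I_n stands for the variable 'X_i, so that graphs on 'I_n are
   graphs with vertices among the variables of {mpoly K[n]}. *)
Record graph (n : nat) := Graph {
  vertices : {set 'I_n};
  edges : {set {set 'I_n}};
  edge_card2 : forall e, e \in edges -> #|e| = 2;
  edge_sub : forall e, e \in edges -> e \subset vertices;
  no_isolated : forall x, x \in vertices -> exists2 e, e \in edges & x \in e;
  edges_neq0 : edges != set0
}.

Definition matching n (G : graph n) (M : {set {set 'I_n}}) : bool :=
  (M \subset edges G) && trivIset M.

Definition induced_edges n (G : graph n) (W : {set 'I_n}) : {set {set 'I_n}} :=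
  [set e in edges G | e \subset W].

Definition induced_matching n (G : graph n) (M : {set {set 'I_n}}) : bool :=
  matching G M && (induced_edges G (cover M) \subset M).

(* M = set0 is always admissible, so the maximum is over a nonempty family. *)
Definition joint_induced_matching_number n d (G : 'I_d -> graph n) : nat :=
  (\max_(M : {set {set 'I_n}} | [forall i, induced_matching (G i) M]) #|M|)%N.

(* Ideals are represented by their membership predicates. *)
Definition ideal_span (A : comNzRingType) (S : A -> Prop) : A -> Prop :=
  fun x => exists (m : nat) (c g : 'I_m -> A),
    (forall i, S (g i)) /\ x = \sum_(i < m) c i * g i.

Definition ideal_prod (A : comNzRingType) d (J : 'I_d -> A -> Prop) :
    A -> Prop :=
  ideal_span (fun x => exists a : 'I_d -> A,
    (forall i, J i (a i)) /\ x = \prod_(i < d) a i).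

Definition edge_ideal (K : fieldType) n (G : graph n) : {mpoly K[n]} -> Prop :=
  ideal_span (fun x => exists i j : 'I_n,
    [set i; j] \in edges G /\ x = 'X_i * 'X_j).

(* Data of a complex ... -> F_1 -> F_0 -> R of graded free modules
     F_i = \bigoplus_(k < rk i) R(- shift i k),
   whose elements are row vectors: the maps are v |-> v *m diff i from F_(i+1)
   to F_i and v |-> v *m aug from F_0 to R. Natural-number shifts suffice for
   resolving ideals of R, which live in nonnegative degrees. *)
Record free_complex (K : fieldType) (n : nat) := FreeComplex {
  rk : nat -> nat;
  shift : forall i, 'I_(rk i) -> nat;
  aug : 'cV[{mpoly K[n]}]_(rk 0);
  diff : forall i, 'M[{mpoly K[n]}]_(rk i.+1, rk i)
}.

(* The second clause says that diff i r c is homogeneous of degree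
   shift (i+1) r - shift i c, and is 0 when this difference is negative. The
   last clause is minimality: the image of diff i lies in (x_1,...,x_n) F_i. *)
Definition minimal_graded_free_resolution (K : fieldType) n
    (I : {mpoly K[n]} -> Prop) (F : free_complex K n) : Prop :=
  [/\ forall k, aug F k 0 \is (shift k).-homog,
      forall i r c m, m \in msupp (diff F i r c) ->
        (mdeg m + shift c = shift r)%N,
      forall f, I f <-> exists v : 'rV_(rk F 0), f = (v *m aug F) 0 0,
      (forall v : 'rV_(rk F 0),
         v *m aug F = 0 <-> exists w, v = w *m diff F 0) /\
      (forall i (v : 'rV_(rk F i.+1)),
         v *m diff F i = 0 <-> exists w, v = w *m diff F i.+1)
    & forall i r c, (diff F i r c)@_0%MM = 0].

(* The multiplicity of R(-j) as a summand of F_i. *)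
Definition betti (K : fieldType) n (F : free_complex K n) (i j : nat) : nat :=
  #|[set k : 'I_(rk F i) | shift k == j]|.

(* reg(I) = r, as a relation: r is the maximum of the j - i with beta_(i,j)
   nonzero. Minimal graded free resolutions of an ideal exist and are unique up
   to isomorphism, so the Betti numbers do not depend on the choice of F, and
   the relation is functional and, for I nonzero, total. *)
Definition is_regularity (K : fieldType) n (I : {mpoly K[n]} -> Prop) (r : int)
    : Prop :=
  exists F : free_complex K n,
    [/\ minimal_graded_free_resolution I F,
        exists i j : nat, betti F i j != 0%N /\ r = j%:Z - i%:Z
      & forall i j : nat, betti F i j != 0%N -> j%:Z - i%:Z <= r].

(* Main.v *)
(* Let {x_1,y_1}, ..., {x_s,y_s} be a maximum joint induced matching (s >= 1, since
   an edge of G_1 is an edge of every G_i) and I = J_1...J_d. The Koszul chain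
   z = (x_1 y_1)^(d-1) x_1...x_s e_(y_1)...e_(y_s) is a cycle modulo I. For a choice
   T of one vertex per matching edge, let T' be the set of the other endpoints, and
   let phi be the sum over T of the coefficients at (x_1 y_1)^(d-1) (prod T) e_(T').
   Then phi(z) = 1, but phi kills boundaries (opposite signs along the edges of the
   cube of choices) and chains with coefficients in I (T is independent in every
   G_i, so monomials of I have degree at least d outside T). Hence Tor_s(R/I,K) is
   nonzero in degree 2(d-1) + 2s; comparing the Koszul complex with the given
   resolution forces a shift at least 2(d-1) + 2s in F_(s-1), and
   reg >= 2(d-1) + 2s - (s-1). *)
Require Import Defs.
From HB Require Import structures.
From mathcomp Require Import all_boot all_order all_algebra.
From mathcomp Require Import mpoly zify.

Set Implicit Arguments.
Unset Strict Implicit.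
Unset Printing Implicit Defensive.

Import Order.TTheory GRing.Theory Num.Theory.
Local Open Scope ring_scope.

(** * Koszul complexes with coefficients in a module *)

Section Koszul.
Variable R : comNzRingType.
Implicit Types (M N : lmodType R) (s : seq R) (h : nat).

(* The Koszul complex of x :: s is the mapping cone of x on that of s: the pair
   (a, b) stands for a + b e_x. All homological degrees are lumped together. *)
Fixpoint koszul M s : lmodType R :=
  if s is _ :: s' then (koszul M s' * koszul M s')%type else M.

Fixpoint kbd M s : koszul M s -> koszul M s :=
  if s is x :: s' return koszul M s -> koszul M s
  then fun u : koszul M s' * koszul M s' => (kbd u.1 + x *: u.2, - kbd u.2)
  else fun=> 0.

Lemma kbd_is_linear M s : linear (@kbd M s).
Proof.
elim: s => [|x s IHs] c u v /=; first by rewrite scaler0 addr0.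
congr pair; last by rewrite /= IHs opprD scalerN.
rewrite /= IHs !scalerDr !scalerA [x * c]mulrC -!addrA; congr (_ + _).
by rewrite addrCA.
Qed.

HB.instance Definition _ M s :=
  GRing.isLinear.Build R (koszul M s) (koszul M s) *:%R (@kbd M s)
    (@kbd_is_linear M s).

Lemma kbdK M s (u : koszul M s) : kbd (kbd u) = 0.
Proof.
elim: s u => [|x s IHs] //= [a b] /=.
by rewrite linearD linearZ (linearN (@kbd M s)) /= !IHs !oppr0 add0r scalerN subrr.
Qed.

Fixpoint kmap M N (f : M -> N) s : koszul M s -> koszul N s :=
  if s is _ :: s' return koszul M s -> koszul N s
  then fun u : koszul M s' * koszul M s' => (kmap f u.1, kmap f u.2)
  else f.

Lemma kmap_is_linear M N (f : {linear M -> N}) s : linear (@kmap M N f s).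
Proof.
elim: s => [|x s IHs] c u v /=; first exact: linearP.
by rewrite !IHs.
Qed.

HB.instance Definition _ M N (f : {linear M -> N}) s :=
  GRing.isLinear.Build R (koszul M s) (koszul N s) *:%R (@kmap M N f s)
    (@kmap_is_linear M N f s).

Lemma kmap_kbd M N (f : {linear M -> N}) s (u : koszul M s) :
  kmap f (kbd u) = kbd (kmap f u).
Proof.
elim: s u => [|x s IHs] u /=; first exact: linear0.
by rewrite linearD linearZ (linearN (@kmap M N f s)) /= !IHs.
Qed.

Lemma kmap_comp0 M N (P : lmodType R) (f : M -> N) (g : N -> P) s (u : koszul M s) :
  (forall m, g (f m) = 0) -> kmap g (kmap f u) = 0.
Proof.
move=> gf0; elim: s u => [|x s IHs] u /=; first exact: gf0.
by rewrite !IHs.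
Qed.

Fixpoint khead M s : koszul M s -> M :=
  if s is _ :: s' return koszul M s -> M
  then fun u : koszul M s' * koszul M s' => khead u.1 else id.

Lemma khead_is_linear M s : linear (@khead M s).
Proof. by elim: s => [|x s IHs] c u v //=; apply: IHs. Qed.

HB.instance Definition _ M s :=
  GRing.isLinear.Build R (koszul M s) M *:%R (@khead M s) (@khead_is_linear M s).

Lemma khead_kmap M N (f : M -> N) s (u : koszul M s) :
  khead (kmap f u) = f (khead u).
Proof. by elim: s u => [|x s IHs] u //=; apply: IHs. Qed.

Fixpoint kconst M s (m : M) : koszul M s :=
  if s is _ :: s' return koszul M s then (kconst s' m, 0) else m.

Lemma khead_const M s (m : M) : khead (kconst s m) = m.
Proof. by elim: s => [|x s IHs] //=. Qed.

Lemma kbd_const M s (m : M) : kbd (kconst s m) = 0.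
Proof.
by elim: s => [|x s IHs] //=; rewrite IHs scaler0 addr0 linear0 oppr0.
Qed.

(* m lies in the submodule (s)M. *)
Fixpoint in_smul M s (m : M) : Prop :=
  if s is x :: s' then exists m' : M, in_smul s' (m - x *: m') else m = 0.

Lemma in_smulP M s c (m1 m2 : M) :
  in_smul s m1 -> in_smul s m2 -> in_smul s (c *: m1 + m2).
Proof.
elim: s m1 m2 => [|x s IHs] m1 m2 /=; first by move=> -> ->; rewrite scaler0 addr0.
move=> [a ha] [b hb]; exists (c *: a + b).
suff -> : c *: m1 + m2 - x *: (c *: a + b)
          = c *: (m1 - x *: a) + (m2 - x *: b) by apply: IHs.
by rewrite scalerDr scalerBr !scalerA [x * c]mulrC opprD addrACA.
Qed.

Lemma in_smul0 M s : in_smul s (0 : M).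
Proof. by elim: s => [|x s IHs] //=; exists 0; rewrite scaler0 subr0. Qed.

Lemma in_smulN M s (m : M) : in_smul s m -> in_smul s (- m).
Proof. by move=> hm; rewrite -scaleN1r -[_ *: _]addr0; apply/in_smulP/in_smul0. Qed.

Lemma in_smul_khead_kbd M s (u : koszul M s) : in_smul s (khead (kbd u)).
Proof.
elim: s u => [|x s IHs] //= [a b] /=; exists (khead b).
by rewrite linearD linearZ addrK; apply: IHs.
Qed.

(* s is a weakly regular sequence on M, read from its last element. *)
Fixpoint regular M s : Prop :=
  if s is x :: s' then
    (forall m : M, in_smul s' (x *: m) -> in_smul s' m) /\ regular M s'
  else True.

(* The head is the component in homological degree 0, where the homology M/(s)M
   need not vanish. *)
Lemma koszul_exact M s (u : koszul M s) : regular M s ->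
  kbd u = 0 -> in_smul s (khead u) -> exists2 v, khead v = 0 & u = kbd v.
Proof.
move=> reg_s bu hu.
suff [v ->] : exists v, u = kbd v.
  (* A constant chain is a cycle, so the head of [v] can be removed. *)
  exists (v - kconst s (khead v)); first by rewrite linearB /= khead_const subrr.
  by rewrite linearB /= kbd_const subr0.
elim: s u reg_s bu hu => [|x s IHs] /=; first by move=> u _ _ ->; exists 0.
move=> [a b] [reg_x reg_s] /= [ba bb] [c hc].
have {bb}bb : kbd b = 0 by rewrite -[kbd b]opprK bb oppr0.
(* [x *: b] is a boundary up to sign, so its head lies in (s)M; regularity of [x] then puts the head
   of [b] there. *)
have [|b' b'E] := IHs b reg_s bb.
  apply: reg_x; rewrite -linearZ /=.
  have -> : x *: b = - kbd a by apply/eqP; rewrite -addr_eq0 addrC ba.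
  by rewrite linearN; apply/in_smulN/in_smul_khead_kbd.
(* The constant is chosen so that [a + x *: b2] has head [khead a - x *: c], which lies in (s)M by
   [hc]. *)
pose b2 := b' - kconst s (c + khead b').
have b2E : kbd b2 = b by rewrite linearB /= kbd_const subr0.
have [||a' a'E] := IHs (a + x *: b2) reg_s.
- by rewrite linearD linearZ /= b2E.
- rewrite linearD linearZ linearB /= khead_const.
  by rewrite opprD addrCA subrr addr0 scalerN.
exists (a', - b2) => /=; congr pair; last by rewrite linearN /= b2E opprK.
by rewrite -a'E scalerN addrK.
Qed.

(* [kall P h u]: u is concentrated in homological degree h, and its coordinates
   there satisfy P. *)
Fixpoint kall M (P : M -> Prop) h s : koszul M s -> Prop :=
  match s return koszul M s -> Prop with
  | [::] => fun u => if h is 0 then P u else u = 0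
  | _ :: s' => fun u : koszul M s' * koszul M s' =>
      kall P h u.1 /\ (if h is h'.+1 then kall P h' u.2 else u.2 = 0)
  end.

Lemma kall0 M (P : M -> Prop) h s : P 0 -> kall P h (0 : koszul M s).
Proof. by move=> P0; elim: s h => [|x s IHs] [|h] //=. Qed.

Lemma kall_const M (P : M -> Prop) s (m : M) : P m -> kall P 0 (kconst s m).
Proof. by move=> Pm; elim: s => [|x s IHs] //=. Qed.

Lemma kallD M (P : M -> Prop) h s (u v : koszul M s) :
  (forall a b, P a -> P b -> P (a + b)) ->
  kall P h u -> kall P h v -> kall P h (u + v).
Proof.
move=> PD; elim: s h u v => [|x s IHs] [|h] u v /=; first exact: PD.
- by move=> -> ->; rewrite addr0.
- by move=> [u1 u2] [v1 v2]; split; [apply: IHs | rewrite /= u2 v2 addr0].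
- by move=> [u1 u2] [v1 v2]; split; apply: IHs.
Qed.

Lemma kallZ M (P Q : M -> Prop) c h s (u : koszul M s) :
  (forall m, P m -> Q (c *: m)) -> kall P h u -> kall Q h (c *: u).
Proof.
move=> PZ; elim: s h u => [|x s IHs] [|h] u /=; first exact: PZ.
- by move=> ->; rewrite scaler0.
- by move=> [u1 u2]; split; [apply: IHs | rewrite /= u2 scaler0].
- by move=> [u1 u2]; split; apply: IHs.
Qed.

Lemma kallW M N (f : {linear M -> N}) (P Q : M -> Prop) h s (u : koszul M s) :
  (forall m, P m -> f m = 0 -> Q m) -> kall P h u -> kmap f u = 0 -> kall Q h u.
Proof.
move=> PQ; elim: s h u => [|x s IHs] [|h] u //=; first exact: PQ.
- by move=> [u1 u2] [fu1 _]; split=> //; apply: IHs.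
- by move=> [u1 u2] [fu1 fu2]; split; apply: IHs.
Qed.

Lemma kall_and M (P Q : M -> Prop) h s (u : koszul M s) :
  kall P h u -> kall Q h u -> kall (fun m => P m /\ Q m) h u.
Proof.
elim: s h u => [|x s IHs] [|h] u //=.
- by move=> [u1 u2] [v1 v2]; split=> //; apply: IHs.
- by move=> [u1 u2] [v1 v2]; split; apply: IHs.
Qed.

Lemma kall_lift M N (f : {linear M -> N}) (P : N -> Prop) (Q : M -> Prop) h s
    (u : koszul N s) :
  (forall m, P m -> exists2 m', Q m' & f m' = m) -> kall P h u ->
  exists2 v : koszul M s, kall Q h v & kmap f v = u.
Proof.
move=> PQ; elim: s h u => [|x s IHs] [|h] u /=; first exact: PQ.
- by move=> ->; exists 0; rewrite ?linear0.
- case: u => a b [/IHs[a' Qa' fa'] /= b0].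
  by exists (a', 0); rewrite //= fa' linear0 b0.
- case: u => a b [/IHs[a' Qa' fa'] /IHs[b' Qb' fb']].
  by exists (a', b'); rewrite //= fa' fb'.
Qed.

Lemma khead_kall M (P : M -> Prop) h s (u : koszul M s) :
  kall P h u -> if h is 0 then P (khead u) else khead u = 0.
Proof. by elim: s h u => [|x s IHs] [|h] u //= [u1 _]; apply: IHs u1. Qed.

Lemma kbd_kall0 M (P : M -> Prop) s (u : koszul M s) : kall P 0 u -> kbd u = 0.
Proof.
elim: s u => [|x s IHs] //= [a b] [/= /IHs -> ->].
by rewrite scaler0 addr0 linear0 oppr0.
Qed.

Lemma kall_kbd M (P Q : M -> Prop) h s (u : koszul M s) :
  Q 0 -> (forall a b, Q a -> Q b -> Q (a + b)) -> (forall a, Q a -> Q (- a)) ->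
  (forall x m, x \in s -> P m -> Q (x *: m)) ->
  kall P h.+1 u -> kall Q h (kbd u).
Proof.
move=> Q0 QD QN; elim: s h u => [|x s IHs] h u PZ /=; first by case: h.
have{} IHs h' (v : koszul M s) : kall P h'.+1 v -> kall Q h' (kbd v).
  by apply: IHs => y m sy; apply: PZ; rewrite inE sy orbT.
case=> u1 u2; split.
  apply: kallD => //; first exact: IHs.
  by apply: (kallZ _ u2) => m; apply: PZ; rewrite mem_head.
case: h u1 u2 => [|h] _ u2; first by rewrite (kbd_kall0 u2) oppr0.
rewrite -scaleN1r; apply: (kallZ (P := Q)); last exact: IHs.
by move=> m; rewrite scaleN1r; apply: QN.
Qed.

End Koszul.

(** * Supports of polynomials *)

Section Monomials.
Variables (K : nzRingType) (n : nat).
Implicit Types (p q : {mpoly K[n]}) (m : 'X_{1..n}).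

Definition mfilter (P : pred 'X_{1..n}) p : {mpoly K[n]} :=
  \sum_(m <- msupp p | P m) p@_m *: 'X_[m].

Lemma mcoeff_mfilter P p m : (mfilter P p)@_m = if P m then p@_m else 0.
Proof.
rewrite /mfilter raddf_sum /=.
under eq_bigr do rewrite mcoeffZ mcoeffX.
have [Pm|/negbTE NPm] := ifPn; last first.
  rewrite big1_seq // => m' /andP[Pm' _]; case: eqP => [mE|_]; last by rewrite mulr0.
  by rewrite -mE Pm' in NPm.
have [mp|mp] := boolP (m \in msupp p).
  rewrite big_mkcond /= (bigD1_seq m) ?msupp_uniq //= Pm eqxx mulr1 big1 ?addr0 // => m' /negbTE ->.
  by rewrite mulr0 if_same.
rewrite (memN_msupp_eq0 mp) big1_seq // => m' /andP[_ m'p].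
by case: eqP => [mE|_]; [rewrite -mE m'p in mp | rewrite mulr0].
Qed.

Lemma mem_msuppM p q m : m \in msupp (p * q) ->
  exists m1 m2, [/\ m1 \in msupp p, m2 \in msupp q & m = (m1 + m2)%MM].
Proof. by move/msuppM_le/allpairsP => [[m1 m2] /= [? ? ->]]; exists m1, m2. Qed.

Lemma mem_msuppD p q m : m \in msupp (p + q) -> m \in msupp p \/ m \in msupp q.
Proof. by move/msuppD_le; rewrite mem_cat => /orP. Qed.

Lemma mem_msupp_sum (I : eqType) (r : seq I) (F : I -> {mpoly K[n]}) m :
  m \in msupp (\sum_(i <- r) F i) -> exists2 i, i \in r & m \in msupp (F i).
Proof. by move/msupp_sum_le/flatten_mapP; rewrite filter_predT. Qed.

Lemma mpoly_eq0P p : (forall m, m \notin msupp p) -> p = 0.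
Proof. by move=> p0; apply/mpolyP => m; rewrite mcoeff0 memN_msupp_eq0. Qed.

End Monomials.

(** * The Koszul complex of the variables and its comparison with a graded exact complex *)

Section VariableSequence.
Variables (K : fieldType) (n : nat).
Implicit Types (l : seq 'I_n) (p q : {mpoly K[n]}) (m : 'X_{1..n}).

Definition xvars l : seq {mpoly K[n]} := [seq 'X_i | i <- l].

Lemma mem_msuppXM (i : 'I_n) p m :
  m \in msupp ('X_i * p) -> exists2 m', m' \in msupp p & m = (m' + U_(i))%MM.
Proof.
rewrite mulrC (perm_mem (msuppMX _ _)) => /mapP[m' m'p ->].
by exists m'; rewrite // addmC.
Qed.

Lemma mpoly_div_var (i : 'I_n) p :
  exists q, forall m, (p - 'X_i * q)@_m = if (0 < m i)%N then 0 else p@_m.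
Proof.
exists (\sum_(m <- msupp p | (0 < m i)%N) p@_m *: 'X_[m - U_(i)]) => m.
rewrite mulr_sumr (_ : \sum_(_ <- _ | _) _ = mfilter (fun m => 0 < m i)%N p).
  by rewrite mcoeffB mcoeff_mfilter; case: ifP; rewrite ?subrr ?subr0.
apply: eq_bigr => m' m'i; rewrite -scalerAr -mpolyXD addmC submK //.
by apply/mnm_lepP => j; rewrite mnm1E; case: eqP => // <-.
Qed.

Lemma in_smul_varsP l k (v : 'rV[{mpoly K[n]}]_k) :
  in_smul (xvars l) v <->
  forall c m, m \in msupp (v 0 c) -> has (fun i => 0 < m i)%N l.
Proof.
elim: l v => [|i l IHl] v /=; split.
- by move=> -> c m; rewrite mxE msupp0.
- move=> v0; apply/rowP => c; rewrite mxE; apply: mpoly_eq0P => m.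
  by apply/negP => /v0.
- move=> [w /IHl wP] c m.
  rewrite -[v](subrK ('X_i *: w)) mxE => /mem_msuppD[/wP -> | ]; first by rewrite orbT.
  rewrite mxE => /mem_msuppXM[m' _ ->].
  by rewrite mnmDE mnm1E eqxx addn1.
- move=> vP; have [q qP] := fin_all_exists (fun c => mpoly_div_var i (v 0 c)).
  exists (\row_c q c); apply/IHl => c m.
  rewrite !mxE mcoeff_msupp qP; case: ifP => [|mi]; first by rewrite eqxx.
  by rewrite -mcoeff_msupp => /vP; rewrite mi.
Qed.

(** If every monomial of ['X_i *: v] involves a variable of [l], so does every monomial of [v],
    because [i] itself is not in [l]. *)
Lemma regular_vars l k : uniq l -> regular 'rV[{mpoly K[n]}]_k (xvars l).
Proof.
elim: l => [|i l IHl] //= /andP[il /IHl reg_l]; split=> // v /in_smul_varsP vP.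
apply/in_smul_varsP => c m mv.
have /vP : (m + U_(i))%MM \in msupp (('X_i *: v) 0 c).
  by rewrite mxE mcoeff_msupp mulrC addmC mcoeffMX -mcoeff_msupp.
move=> /hasP[j jl]; rewrite mnmDE mnm1E; case: eqP => [ij|_]; last first.
  by rewrite addn0 => mj; apply/hasP; exists j.
by rewrite ij jl in il.
Qed.

(** The homogeneous elements of degree e in the graded free module whose c-th generator has degree
    [sh c]. *)
Definition homogrow k (sh : 'I_k -> nat) (e : nat) (v : 'rV[{mpoly K[n]}]_k) :=
  forall c m, m \in msupp (v 0 c) -> (mdeg m + sh c)%N = e.

(** Keep only the terms of [w] of total degree e. Since D preserves degrees, the discarded terms
    contribute nothing in degree e, where the whole image lives. *)
Lemma homog_lift k k' (D : 'M[{mpoly K[n]}]_(k, k')) sh sh' e w :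
  (forall r c m, m \in msupp (D r c) -> (mdeg m + sh' c)%N = sh r) ->
  homogrow sh' e (w *m D) -> exists2 w', homogrow sh e w' & w' *m D = w *m D.
Proof.
move=> DP wDP; pose P c m := (mdeg m + sh c)%N == e.
pose w' := \row_c mfilter (P c) (w 0 c).
have w'P : homogrow sh e w'.
  move=> c m; rewrite mxE mcoeff_msupp mcoeff_mfilter.
  by case: ifP => [/eqP //|]; rewrite eqxx.
exists w' => //; apply/esym/eqP; rewrite -subr_eq0 -mulmxBl; apply/eqP/rowP => c.
rewrite [RHS]mxE; apply: mpoly_eq0P => m; apply/negP => mD.
have mN : (mdeg m + sh' c)%N <> e.
  move: mD; rewrite mxE => /mem_msupp_sum[r _ /mem_msuppM[m1 [m2 [m1w m2D ->]]]].
  rewrite mdegD -addnA (DP _ _ _ m2D) => /eqP; rewrite -/(P r m1) => Pm1.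
  by move: m1w; rewrite !mxE mcoeff_msupp mcoeffB mcoeff_mfilter Pm1 subrr eqxx.
move: mD; rewrite mulmxBl mxE => /mem_msuppD[/wDP //|].
rewrite mxE (perm_mem (msuppN _)) mxE.
move=> /mem_msupp_sum[r _ /mem_msuppM[m1 [m2 [m1w m2D mE]]]].
by apply: mN; rewrite mE mdegD -addnA (DP _ _ _ m2D) (w'P _ _ m1w).
Qed.

(* The maps D_i form an exact complex, of which only the first term N_0 may have
   homology; a Koszul chain z over N_0 that is a cycle modulo im D_0 lifts step by
   step to a Koszul 0-chain over N_j. If the shifts of N_j are too small, that
   0-chain has positive polynomial degree, so it is a boundary, and this descends
   back to z. *)
Lemma koszul_zigzag (N : nat -> nat) (D : forall i, 'M[{mpoly K[n]}]_(N i.+1, N i))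
    (sh : forall i, 'I_(N i) -> nat) (l : seq 'I_n) :
  uniq l -> (forall j, j \in l) ->
  (forall i r c m, m \in msupp (D i r c) -> (mdeg m + sh i c)%N = sh i.+1 r) ->
  (forall i (v : 'rV_(N i.+1)), v *m D i = 0 <-> exists w, v = w *m D i.+1) ->
  forall h i j e (z : koszul 'rV_(N i) (xvars l)),
  j = (i + h)%N -> (forall k, sh j k < e + h)%N ->
  kall (homogrow (sh i) e) h z ->
  kall (fun v => exists w, v = w *m D i) h.-1 (kbd z) ->
  exists w w', khead w = 0 /\ z = kbd w + kmap (mulmxr (D i)) w'.
Proof.
(* Each step replaces (i, h, e) by (i+1, h-1, e+1), so i + h and e + h stay constant. *)
move=> l_uniq l_full Dhom Dex; elim=> [|h IHh] i j e z jE sh_lt zh bz.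
  rewrite addn0 in jE; subst j.
  have [|w w0 zE] := koszul_exact (regular_vars (N i) l_uniq) (kbd_kall0 zh).
    apply/in_smul_varsP => c m /(khead_kall zh) mE.
    have := sh_lt c; rewrite addn0 -mE -[ltnLHS]add0n ltn_add2r.
    rewrite mdegE lt0n; apply: contraNT => /hasPn lN; apply/eqP/big1 => c' _.
    by apply/eqP; rewrite -leqn0 leqNgt; apply: lN.
  by exists w, 0; split=> //; rewrite linear0 addr0.
have bzh : kall (homogrow (sh i) e.+1) h (kbd z).
  apply: kall_kbd zh.
  - by move=> c m; rewrite mxE msupp0.
  - by move=> a b ah bh c m; rewrite mxE => /mem_msuppD[/ah|/bh].
  - by move=> a ah c m; rewrite mxE (perm_mem (msuppN _)) => /ah.
  - move=> x m /mapP[v _ ->] mh c m'; rewrite mxE => /mem_msuppXM[m1 /mh m1E ->].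
    by rewrite mdegD mdeg1 addn1 addSn m1E.
have [|z1 z1h z1E] := kall_lift (f := mulmxr (D i)) (Q := homogrow (sh i.+1) e.+1)
  _ (kall_and bzh bz).
  move=> m [mh [w mE]]; rewrite mE in mh *.
  by have [w' w'h w'E] := homog_lift (Dhom i) mh; exists w'.
have [||||w [w' [w0 z1E']]] := IHh i.+1 j e.+1 z1.
- by rewrite jE addSnnS.
- by move=> k; rewrite addSnnS.
- by [].
- case: h {IHh sh_lt zh bz bzh jE} z1h => [|h] z1h.
    by rewrite (kbd_kall0 z1h); apply: kall0; exists 0; rewrite mul0mx.
  apply: (kallW (f := mulmxr (D i)) (P := fun=> True)).
  + by move=> m _ /Dex.
  + by apply: kall_kbd z1h.
  + by rewrite kmap_kbd z1E kbdK.
(* The difference is a cycle because consecutive maps D compose to 0. Its head vanishes thanks to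
   [khead w = 0], which is why the conclusion carries that clause. *)
have [||v v0 zE] := @koszul_exact _ _ _ (z - kmap (mulmxr (D i)) w)
  (regular_vars (N i) l_uniq).
- rewrite linearB /= -kmap_kbd -z1E z1E' linearD /= kmap_comp0 ?addr0 ?subrr //.
  by move=> m /=; apply/Dex; exists m.
- by rewrite linearB /= (khead_kall zh) khead_kmap w0 linear0 subr0; apply: in_smul0.
by exists v, w; split=> //; rewrite -zE subrK.
Qed.
End VariableSequence.

(** * The Koszul cycle of a matching and the cocycle detecting it *)

Section MatchingCycle.
Variables (K : fieldType) (n : nat).
Implicit Types (ps : seq ('I_n * 'I_n)) (l : seq 'I_n) (mu : 'X_{1..n}).
Local Notation R := {mpoly K[n]}.

(** Listing the two ends of a pair consecutively makes the Koszul complex unfold into four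
    components per pair; [l] is meant for the unmatched vertices. *)
Fixpoint with_pairs ps l : seq 'I_n :=
  if ps is p :: ps' then p.1 :: p.2 :: with_pairs ps' l else l.

Lemma with_pairs_cat ps l : with_pairs ps l = with_pairs ps [::] ++ l.
Proof. by elim: ps => //= p ps ->. Qed.

Local Notation kpairs ps l := (koszul 'rV[R]_1 (xvars K (with_pairs ps l))).

(* X^mu x_1 ... x_s e_(y_1) ... e_(y_s) for ps = [(x_1, y_1); ...; (x_s, y_s)]. *)
Fixpoint matching_cycle ps l mu : kpairs ps l :=
  if ps is p :: ps' return kpairs ps l
  then ((0, matching_cycle ps' l (mu + U_(p.1))%MM), (0, 0))
  else kconst _ (const_mx 'X_[mu]).

(* The sum, over the choices T of one vertex in each pair, of the coefficient of
   X^mu (prod T) at the exterior monomial of the vertices not in T. *)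
Fixpoint matching_cocycle ps l mu : kpairs ps l -> K :=
  if ps is p :: ps' return kpairs ps l -> K
  then fun u : (kpairs ps' l * kpairs ps' l) * (kpairs ps' l * kpairs ps' l) =>
    matching_cocycle (mu + U_(p.1))%MM u.1.2
    + matching_cocycle (mu + U_(p.2))%MM u.2.1
  else fun u => (khead u 0 0)@_mu.

Lemma matching_cocycleD ps l mu (u v : kpairs ps l) :
  matching_cocycle mu (u + v) = matching_cocycle mu u + matching_cocycle mu v.
Proof.
elim: ps mu u v => [|p ps IHps] mu u v /=; first by rewrite linearD mxE mcoeffD.
by rewrite !IHps addrACA.
Qed.

Lemma matching_cocycle0 ps l mu : matching_cocycle mu (0 : kpairs ps l) = 0.
Proof.
apply: (addrI (matching_cocycle mu (0 : kpairs ps l))).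
by rewrite -matching_cocycleD !addr0.
Qed.

Lemma matching_cocycleN ps l mu (u : kpairs ps l) :
  matching_cocycle mu (- u) = - matching_cocycle mu u.
Proof.
by apply/eqP; rewrite -addr_eq0 -matching_cocycleD addNr matching_cocycle0.
Qed.

Lemma matching_cocycleX ps l mu i (u : kpairs ps l) :
  matching_cocycle (mu + U_(i))%MM ('X_i *: u) = matching_cocycle mu u.
Proof.
elim: ps mu u => [|p ps IHps] mu u /=.
  by rewrite linearZ mxE mulrC addmC mcoeffMX.
by rewrite -!addmA ![(U_(i) + _)%MM]addmC !addmA !IHps.
Qed.

(* An (s+1)-chain meets the cocycle only through an edge of the cube of choices,
   i.e. through some e_x e_y: its two ends contribute opposite coefficients. *)
Lemma matching_cocycle_kbd ps l mu (u : kpairs ps l) :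
  uniq (with_pairs ps l) -> (forall j, j \in l -> mu j = 0%N) ->
  matching_cocycle mu (kbd u) = 0.
Proof.
elim: ps mu u => [|p ps IHps] mu u /= uniq_l mu_l.
  (* The head of a boundary has only monomials involving a variable of [l], and [mu] involves
     none. *)
  apply/eqP; rewrite mcoeff_eq0; apply/negP.
  move: (in_smul_khead_kbd u) => /in_smul_varsP ul /ul /hasP[j /mu_l ->].
  by rewrite ltnn.
have IH i v : i \in [:: p.1; p.2] ->
    @matching_cocycle ps l (mu + U_(i))%MM (kbd v) = 0.
  move=> ip; apply: IHps; first by case/and3P: uniq_l.
  move=> j jl; rewrite mnmDE mu_l // mnm1E; case: eqP => // ij.
  have : j \in with_pairs ps l by rewrite with_pairs_cat mem_cat jl orbT.
  rewrite -ij; case/and3P: uniq_l ip; rewrite !inE negb_or => /andP[_ p1] p2 _.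
  by case/orP=> /eqP ->; rewrite ?(negbTE p1) ?(negbTE p2).
case: u => [[a b] [c e]] /=.
rewrite !(matching_cocycleD, matching_cocycleN) !IH ?inE ?eqxx ?orbT //.
by rewrite !matching_cocycleX oppr0 !add0r subrr.
Qed.

Lemma matching_cocycle_cycle ps l mu : matching_cocycle mu (matching_cycle ps l mu) = 1.
Proof.
elim: ps mu => [|p ps IHps] mu /=; first by rewrite khead_const mxE mcoeffX eqxx.
by rewrite IHps matching_cocycle0 addr0.
Qed.

Lemma kall_matching_cycle (P : 'rV[R]_1 -> Prop) ps l mu :
  P 0 -> (forall m, mdeg m = size ps -> P (const_mx 'X_[mu + m])) ->
  kall P (size ps) (matching_cycle ps l mu).
Proof.
move=> P0; elim: ps mu => [|p ps IHps] mu /= PX.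
  by apply: kall_const; rewrite -[mu]addm0; apply: PX; rewrite mdeg0.
split; last exact: (@kall0 _ _ P _ ('X_p.2 :: xvars K (with_pairs ps l))).
split; first exact: kall0.
by apply: IHps => m mE; rewrite -addmA; apply: PX; rewrite mdegD mdeg1 mE.
Qed.

(** Each term of the boundary trades some e_y for the variable y, so its coefficient is, up to sign,
    a monomial divisible by X^mu x y for that pair (x, y). *)
Lemma kall_kbd_matching_cycle (P : 'rV[R]_1 -> Prop) ps l mu :
  P 0 -> (forall v, P v -> P (- v)) ->
  (forall p m, p \in ps -> P (const_mx 'X_[mu + m + U_(p.1) + U_(p.2)])) ->
  kall P (size ps).-1 (kbd (matching_cycle ps l mu)).
Proof.
move=> P0 PN; elim: ps mu => [|p ps IHps] mu PX /=.
  by rewrite kbd_const; apply: kall0.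
rewrite !scaler0 !linear0 !addr0 !add0r oppr0.
have XP : kall P (size ps) ('X_p.2 *: matching_cycle ps l (mu + U_(p.1))%MM).
  apply: (kallZ (P := fun v => P ('X_p.2 *: v))) => //.
  apply: kall_matching_cycle; first by rewrite scaler0.
  move=> m _.
  have -> : 'X_p.2 *: const_mx 'X_[mu + U_(p.1) + m]
      = const_mx 'X_[mu + m + U_(p.1) + U_(p.2)] :> 'rV[R]_1.
    apply/rowP => c; rewrite !mxE -mpolyXD addmC; congr 'X_[_ + _].
    by rewrite -!addmA [(m + _)%MM]addmC.
  by apply: PX; rewrite mem_head.
(* With a single pair the boundary has homological degree 0, so its remaining components must be
   zero. *)
case: ps IHps PX XP => [|p' ps] IHps PX XP.
  do !split=> //.
    by rewrite /= kbd_const oppr0.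
split; last first.
  rewrite oppr0; split; first exact: (@kall0 _ _ P _ (xvars K (with_pairs (p' :: ps) l)) P0).
  by case: (size ps) => // h; exact: (@kall0 _ _ P _ (xvars K (with_pairs (p' :: ps) l)) P0).
split; first exact: XP.
rewrite -scaleN1r; apply: (kallZ (P := P)); first by move=> v; rewrite scaleN1r; apply: PN.
apply: (IHps (mu + U_(p.1))%MM) => q m qps.
rewrite -[(mu + _ + m)%MM]addmA; apply: PX.
by rewrite inE qps orbT.
Qed.

(** These are the choices T over which the cocycle sums. *)
Definition selects (t : seq 'I_n) ps : bool :=
  all2 (fun a p => (a == p.1) || (a == p.2)) t ps.

(** The cocycle reads only coefficients at X^mu times the product of a choice; with [f] the
    augmentation, this says that it kills chains with coefficients in the ideal. *)
Lemma matching_cocycle_kmap (M : lmodType R) (f : M -> 'rV[R]_1) ps l mu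
    (w : koszul M (xvars K (with_pairs ps l))) :
  (forall m t, selects t ps -> (f m 0 0)@_(mu + \sum_(a <- t) U_(a))%MM = 0) ->
  matching_cocycle mu (kmap f w) = 0.
Proof.
elim: ps mu w => [|p ps IHps] mu w /= f0.
  by rewrite khead_kmap; have := f0 (khead w) [::] isT; rewrite big_nil addm0.
have IH i u : (i == p.1) || (i == p.2) ->
    @matching_cocycle ps l (mu + U_(i))%MM (kmap f u) = 0.
  move=> ip; apply: IHps => m t tps.
  by have := f0 m (i :: t); rewrite /= ip big_cons addmA; apply.
by rewrite !IH ?eqxx ?orbT // addr0.
Qed.

Lemma selectsP t ps : selects t ps ->
  {subset t <= with_pairs ps [::]} /\
  (forall p, p \in ps -> (p.1 \in t) || (p.2 \in t)).
Proof.
elim: ps t => [|p ps IHps] [|a t] //= /andP[ap /IHps[tps pst]]; split=> [i|q].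
  by rewrite !inE => /predU1P[->|/tps ->]; rewrite ?orbT // orbA ap.
rewrite !inE => /predU1P[->|/pst].
  by case/orP: ap => /eqP ->; rewrite eqxx ?orbT.
by case/orP=> ->; rewrite !orbT.
Qed.

Lemma with_pairs_mem ps p : p \in ps ->
  (p.1 \in with_pairs ps [::]) && (p.2 \in with_pairs ps [::]).
Proof.
elim: ps => //= q ps IHps; rewrite !inE => /predU1P[->|/IHps/andP[-> ->]].
  by rewrite !eqxx orbT.
by rewrite !orbT.
Qed.

(** As the pairs are disjoint, an end of [p] can be chosen only at the position of [p], where a
    single vertex is chosen. *)
Lemma selects_not_both t ps p : uniq (with_pairs ps [::]) -> selects t ps ->
  p \in ps -> ~~ ((p.1 \in t) && (p.2 \in t)).
Proof.
elim: ps t => [|q ps IHps] [|a t] //= /and3P[q1 q2 ups] /andP[aq sel].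
have [tps _] := selectsP sel.
move: q1; rewrite !inE negb_or => /andP[q12 q1].
have tN i : i \in t -> (q.1 == i) || (q.2 == i) = false.
  move=> /tps it; apply/negbTE; rewrite negb_or.
  by apply/andP; split; [apply: contra q1 | apply: contra q2] => /eqP ->.
case/predU1P=> [->|pps]; apply/negP => /andP[].
  case/orP: aq => /eqP -> /predU1P[p1E|/tN]; rewrite ?eqxx ?orbT //.
    by case/predU1P=> [p2E|/tN]; [rewrite p2E eqxx in q12 | rewrite eqxx orbT].
  by rewrite p1E eqxx in q12.
have /andP[p1 p2] := with_pairs_mem pps.
have aN i : i \in with_pairs ps [::] -> (i == a) = false.
  move=> ip; apply/negbTE; apply/eqP => iE; case/orP: aq => /eqP aE.
    by rewrite -aE -iE ip in q1.
  by rewrite -aE -iE ip in q2.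
rewrite !aN //= => t1 t2.
by have := IHps t ups sel pps; rewrite t1 t2.
Qed.
End MatchingCycle.

(** Were all shifts smaller, the zigzag would write the matching cycle as a boundary plus a chain
    with coefficients in I; the cocycle kills both but takes the value 1 on the cycle. *)
Lemma betti_lower_bound (K : fieldType) n (I : {mpoly K[n]} -> Prop)
    (F : free_complex K n) (ps : seq ('I_n * 'I_n)) (l : seq 'I_n)
    (mu : 'X_{1..n}) :
  minimal_graded_free_resolution I F ->
  uniq (with_pairs ps l) -> (forall j, j \in with_pairs ps l) ->
  (forall j, j \in l -> mu j = 0%N) -> (0 < size ps)%N ->
  (forall p m, p \in ps -> I 'X_[mu + m + U_(p.1) + U_(p.2)]) ->
  (forall f t, I f -> selects t ps -> f@_(mu + \sum_(a <- t) U_(a))%MM = 0) ->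
  exists k : 'I_(rk F (size ps).-1), (mdeg mu + 2 * size ps <= shift k)%N.
Proof.
move=> [aug_hom diff_hom I_aug [ex0 exS] _] ps_uniq ps_full mu_l ps_gt0 I_ps I_sel.
(* The ring R is put in position 0, so F_i moves to position i + 1 and position [size ps] holds F at
   index [(size ps).-1]. *)
pose N i := if i is i'.+1 then rk F i' else 1%N.
pose D i : 'M[{mpoly K[n]}]_(N i.+1, N i) := if i is i'.+1 then diff F i' else aug F.
pose sh i : 'I_(N i) -> nat := if i is i'.+1 then @shift K n F i' else fun=> 0%N.
have Dhom i r c m : m \in msupp (D i r c) -> (mdeg m + sh i c)%N = sh i.+1 r.
  case: i r c => [|i] r c /=; last exact: diff_hom.
  by rewrite addn0 (ord1 c); apply/dhomogP/aug_hom.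
have Dex i (v : 'rV_(N i.+1)) : v *m D i = 0 <-> exists w, v = w *m D i.+1.
  by case: i v => [|i] v; [apply: ex0 | apply: exS].
have [/existsP //|] :=
  boolP [exists k : 'I_(rk F (size ps).-1), (mdeg mu + 2 * size ps <= shift k)%N].
rewrite negb_exists => /forallP shN.
pose z := matching_cycle K ps l mu.
have [||||w [w' [_ zE]]] := @koszul_zigzag K n N D sh _ ps_uniq ps_full Dhom Dex
  (size ps) 0 (size ps) (mdeg mu + size ps) z.
- by [].
- case: (size ps) ps_gt0 shN => //= h _ shN k.
  by rewrite ltnNge -addnA addnn -mul2n; apply: shN.
- apply: kall_matching_cycle; first by move=> c m; rewrite mxE msupp0.
  move=> m mE c m'; rewrite mxE => /mem_msuppXP <-.
  by rewrite mdegD mE addn0.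
- apply: kall_kbd_matching_cycle.
  + by exists 0; rewrite mul0mx.
  + by move=> v [u ->]; exists (- u); rewrite mulNmx.
  + move=> p m /(I_ps _ m) /I_aug[v vE]; exists v; apply/rowP => c.
    by rewrite (ord1 c) mxE.
have := matching_cocycle_cycle K ps l mu; rewrite -/z zE matching_cocycleD.
rewrite matching_cocycle_kbd // matching_cocycle_kmap ?addr0; last first.
  by move=> v t; apply: I_sel; apply/I_aug; exists v.
by move/esym/eqP; rewrite oner_eq0.
Qed.

(** * Edge ideals, degrees outside a vertex set, and matchings *)

Section EdgeIdeals.
Variable n : nat.
Implicit Types (T : {set 'I_n}) (m : 'X_{1..n}).

Definition outdeg T m : nat := \sum_(j | j \notin T) m j.

Lemma outdegD T m1 m2 : outdeg T (m1 + m2)%MM = (outdeg T m1 + outdeg T m2)%N.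
Proof. by rewrite /outdeg -big_split; apply: eq_bigr => j _; rewrite mnmDE. Qed.

Lemma outdegU T i : outdeg T U_(i)%MM = (i \notin T).
Proof.
rewrite /outdeg; under eq_bigr do rewrite mnm1E.
have [iT|iT] := boolP (i \in T).
  by apply: big1 => j jT; case: eqP => // ij; rewrite -ij iT in jT.
by rewrite (bigD1 i) //= eqxx big1 // => j /andP[_ /negbTE]; rewrite eq_sym => ->.
Qed.

Lemma ideal_span_outdeg (K : fieldType) (S : {mpoly K[n]} -> Prop) T k f m :
  (forall g m', S g -> m' \in msupp g -> (k <= outdeg T m')%N) ->
  ideal_span S f -> m \in msupp f -> (k <= outdeg T m)%N.
Proof.
move=> Sk [s [c [g [Sg ->]]]] /mem_msupp_sum[i _ /mem_msuppM[m1 [m2 [_ m2g ->]]]].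
by rewrite outdegD; apply: leq_trans (Sk _ _ (Sg i) m2g) (leq_addl _ _).
Qed.

Lemma edge_ideal_outdeg (K : fieldType) (G : graph n) T (f : {mpoly K[n]}) m :
  (forall e, e \in edges G -> ~~ (e \subset T)) ->
  edge_ideal G f -> m \in msupp f -> (0 < outdeg T m)%N.
Proof.
move=> GT; apply: ideal_span_outdeg => _ m' [i [j [/GT ij ->]]].
rewrite -mpolyXD => /mem_msuppXP <-; rewrite outdegD !outdegU.
move: ij; rewrite subUset !sub1set negb_and.
by case: (i \in T); case: (j \in T).
Qed.

Lemma ideal_prod_outdeg (K : fieldType) d (G : 'I_d -> graph n) T
    (f : {mpoly K[n]}) m :
  (forall i e, e \in edges (G i) -> ~~ (e \subset T)) ->
  ideal_prod (fun i => @edge_ideal K n (G i)) f ->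
  m \in msupp f -> (d <= outdeg T m)%N.
Proof.
move=> GT; apply: ideal_span_outdeg => _ m' [a [Ga ->]].
have a_out (r : seq 'I_d) m1 :
    m1 \in msupp (\prod_(i <- r) a i) -> (size r <= outdeg T m1)%N.
  elim: r m1 => [|i r IHr] m1 //=.
  rewrite big_cons => /mem_msuppM[m2 [m3 [m2a /IHr m3r ->]]].
  by rewrite outdegD -add1n leq_add // (edge_ideal_outdeg (GT i) (Ga i)).
by move/a_out; rewrite -sum1_size big_const_ord iter_addn_0 mul1n.
Qed.

Lemma edge_ideal_edge (K : fieldType) (G : graph n) i j :
  [set i; j] \in edges G -> edge_ideal G ('X_i * 'X_j : {mpoly K[n]}).
Proof.
move=> ij; exists 1%N, (fun=> 1), (fun=> 'X_i * 'X_j).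
by split; [move=> _; exists i, j | rewrite big_ord1 mul1r].
Qed.

(** If an edge e of G were not in H, then e, having two elements, would contain no edge of H;
    monomials of I(H) would have positive degree outside e, unlike the generator of e. *)
Lemma edges_sub_of_ideal_sub (K : fieldType) (G H : graph n) :
  (forall f : {mpoly K[n]}, edge_ideal G f -> edge_ideal H f) ->
  edges G \subset edges H.
Proof.
move=> GH; apply/subsetP => e eG; apply: contraT => eH.
have /eqP/cards2P[i [j [_ eE]]] := edge_card2 eG.
have HN e' : e' \in edges H -> ~~ (e' \subset e).
  move=> e'H; apply: contra eH => e'e.
  by rewrite -(_ : e' = e) //; apply/eqP; rewrite eqEcard e'e !(edge_card2 e'H, edge_card2 eG).
have := edge_ideal_outdeg HN (GH _ (edge_ideal_edge K (i := i) (j := j) _)).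
rewrite -eE => /(_ (U_(i) + U_(j))%MM eG); rewrite -mpolyXD msuppX mem_seq1 eqxx.
by rewrite outdegD !outdegU eE !inE !eqxx orbT => /(_ isT).
Qed.

Lemma joint_induced_matching_number_gt0 (K : fieldType) d (G : 'I_d -> graph n) :
  (0 < d)%N ->
  (forall (i j : 'I_d) (f : {mpoly K[n]}),
     (i <= j)%N -> edge_ideal (G i) f -> edge_ideal (G j) f) ->
  (0 < joint_induced_matching_number G)%N.
Proof.
move=> d_gt0 Gle; pose i0 := Ordinal d_gt0.
have /set0Pn[e eG] := edges_neq0 (G i0).
have eGi i : e \in edges (G i).
  by apply: (subsetP (edges_sub_of_ideal_sub (fun f => Gle i0 i f (leq0n i)))).
rewrite -(cards1 e); apply: leq_bigmax_cond; apply/forallP => i.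
rewrite /induced_matching /matching sub1set eGi trivIset1 /cover big_set1 /=.
apply/subsetP => e'; rewrite !inE => /andP[e'G e'e].
by rewrite eqEcard e'e (edge_card2 e'G) (edge_card2 eG).
Qed.

Lemma with_pairs_matching (M : {set {set 'I_n}}) (f : {set 'I_n} -> 'I_n * 'I_n) :
  trivIset M -> (forall e, e \in M -> e = [set (f e).1; (f e).2] /\ (f e).1 != (f e).2) ->
  uniq (with_pairs [seq f e | e <- enum M] [::]) /\
  with_pairs [seq f e | e <- enum M] [::] =i cover M.
Proof.
move=> /trivIsetP Mtriv fM.
have memE s i : {subset s <= M} ->
    (i \in with_pairs [seq f e | e <- s] [::]) = has (fun e : {set 'I_n} => i \in e) s.
  elim: s => //= e s IHs sM; rewrite !inE IHs; last first.
    by move=> e' e's; apply: sM; rewrite inE e's orbT.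
  by have [eE _] := fM e (sM e (mem_head _ _)); rewrite [in RHS]eE !inE orbA.
split; last first.
  move=> i; rewrite memE; last by move=> e; rewrite mem_enum.
  apply/hasP/bigcupP => -[e eM ie]; exists e => //; first by rewrite mem_enum in eM.
  by rewrite mem_enum.
have: {subset enum M <= M} by move=> e; rewrite mem_enum.
elim: (enum M) (enum_uniq M) => //= e s IHs /andP[es s_uniq] sM.
have sM' : {subset s <= M} by move=> e' e's; apply: sM; rewrite inE e's orbT.
have eM := sM e (mem_head _ _); have [eE f12] := fM e eM.
have eN i : i \in e -> i \notin with_pairs [seq f e' | e' <- s] [::].
  move=> ie; rewrite memE //; apply/hasPn => e' e's.
  have ee' : e != e' by apply: contraNneq es => ->.
  by have /disjointFr-> := Mtriv _ _ eM (sM' _ e's) ee'.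
have e1 : (f e).1 \in e by rewrite [in X in _ \in X]eE !inE eqxx.
have e2 : (f e).2 \in e by rewrite [in X in _ \in X]eE !inE eqxx orbT.
by rewrite inE negb_or f12 (eN _ e1) (eN _ e2) IHs.
Qed.

End EdgeIdeals.

(* If T contains no edge of any G_i, every monomial of the product has degree at
   least d outside T; the monomials read off by the cocycle have degree at most
   d - 1 outside the set T of chosen vertices. *)
Theorem theorem4p1 (K : fieldType) (n d : nat) (G : 'I_d -> graph n)
    (r : int) :
  (1 <= d)%N ->
  (forall (i j : 'I_d) (f : {mpoly K[n]}),
     (i <= j)%N -> edge_ideal (G i) f -> edge_ideal (G j) f) ->
  is_regularity (ideal_prod (fun i : 'I_d => @edge_ideal K n (G i))) r ->
  (2 * d + joint_induced_matching_number G)%:Z - 1 <= r.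
Proof.
move=> d_gt0 Gle [F [Fres _ r_max]].
have J_gt0 := joint_induced_matching_number_gt0 d_gt0 Gle.
have [|M /forallP Mind ME_max] := eq_bigmax_cond
    (A := [pred M : {set {set 'I_n}} | [forall i, induced_matching (G i) M]])
    (fun M : {set {set 'I_n}} => #|M|).
  rewrite lt0n; apply: contraTneq J_gt0 => /card0_eq A0.
  by rewrite -leqNgt leqn0 /joint_induced_matching_number big_pred0.
move: J_gt0; rewrite /joint_induced_matching_number ME_max card_gt0 => /set0Pn[e0 e0M].
pose i0 := Ordinal d_gt0.
have ME i : M \subset edges (G i) by have /andP[/andP[]] := Mind i.
have Mtriv : trivIset M by have /andP[/andP[]] := Mind i0.
(* Stated for every set e so that finite choice applies; outside M the pair of [e0] serves as a
   default. *)
have fex (e : {set 'I_n}) : exists p : 'I_n * 'I_n, e \in M -> e = [set p.1; p.2] /\ p.1 != p.2.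
  have pair e' : e' \in M -> exists p : 'I_n * 'I_n, e' = [set p.1; p.2] /\ p.1 != p.2.
    move=> /(subsetP (ME i0))/edge_card2/eqP/cards2P[x [y [xy ->]]].
    by exists (x, y).
  have [/pair[p pE]|_] := boolP (e \in M); first by exists p.
  by have [p _] := pair _ e0M; exists p.
have [f fM] := fin_all_exists fex.
pose ps := [seq f e | e <- enum M].
have [ps_uniq psE] : uniq (with_pairs ps [::]) /\ with_pairs ps [::] =i cover M.
  exact: with_pairs_matching.
have psP p : p \in ps -> [set p.1; p.2] \in M.
  by move=> /mapP[e]; rewrite mem_enum => eM ->; have [<-] := fM e eM.
pose l := [seq j <- enum 'I_n | j \notin with_pairs ps [::]].
pose p0 := f e0.
have p0ps : p0 \in ps by apply: map_f; rewrite mem_enum.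
pose mu := ((U_(p0.1) + U_(p0.2)) *+ d.-1)%MM.
have lP j : j \in l = (j \notin with_pairs ps [::]).
  by rewrite mem_filter mem_enum andbT.
have mu0 j : j \notin cover M -> mu j = 0%N.
  move=> jM; have p0M i : i \in [set p0.1; p0.2] -> (i == j) = false.
    move=> ip; apply: contraNF jM => /eqP <-.
    by apply/bigcupP; exists [set p0.1; p0.2] => //; apply: psP.
  by rewrite mulmnE mnmDE !mnm1E !p0M // !inE eqxx ?orbT.
have M_gt0 : (0 < #|M|)%N by rewrite card_gt0; apply/set0Pn; exists e0.
have ps_size : size ps = #|M| by rewrite size_map cardE.
have [||||||k] := @betti_lower_bound K n _ F ps l mu Fres.
- rewrite with_pairs_cat cat_uniq ps_uniq filter_uniq ?enum_uniq // andbT /=.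
  by apply/hasPn => j; rewrite lP.
- by move=> j; rewrite with_pairs_cat mem_cat lP orbN.
- by move=> j; rewrite lP psE; apply: mu0.
- by rewrite ps_size.
(* The factor at [i0] is the edge [p]; the other d - 1 factors are the edge [p0] and make up
   [mu]. *)
- move=> p m pps; exists 1%N, (fun=> 'X_[m]), (fun=> 'X_[mu + U_(p.1) + U_(p.2)]).
  split; last by rewrite big_ord1 -mpolyXD [(mu + m)%MM]addmC -!addmA.
  move=> _; exists (fun i => if i == i0 then 'X_(p.1) * 'X_(p.2) else 'X_(p0.1) * 'X_(p0.2)).
  split=> [i|].
    by case: eqP => _; apply: edge_ideal_edge; apply: (subsetP (ME i)); apply: psP.
  rewrite (bigD1 i0) //= ?eqxx (eq_bigr (fun=> 'X_(p0.1) * 'X_(p0.2))); last first.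
    by move=> i /negbTE ->.
  rewrite prodr_const cardC1 card_ord -!mpolyXD mpolyXn -mpolyXD.
  by congr 'X_[_]; rewrite -addmA addmC.
- move=> g t Ig tps; apply/eqP; rewrite mcoeff_eq0; apply/negP => tau.
  have [t_sub t_ps] := selectsP tps.
  pose T := [set i in t].
  have: (d <= outdeg T (mu + \sum_(a <- t) U_(a)))%N.
    apply: ideal_prod_outdeg Ig tau => i e eG; apply/negP => eT.
    (* An edge inside T joins matched vertices, so it belongs to M by inducedness; but T contains
       only one of its ends. *)
    have eM : e \in M.
      have /andP[_ /subsetP] := Mind i; apply; rewrite inE eG /=.
      apply/subsetP => j /(subsetP eT); rewrite inE => /t_sub.
      by rewrite psE.
    have feps : f e \in ps by apply: map_f; rewrite mem_enum.
    have := selects_not_both ps_uniq tps feps.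
    have [eE _] := fM e eM; move: eT; rewrite {1}eE subUset !sub1set !inE.
    by move=> ->.
  have -> : outdeg T (mu + \sum_(a <- t) U_(a)) = (d.-1 * outdeg T (U_(p0.1) + U_(p0.2)))%N.
    rewrite outdegD [X in (_ + X)%N](_ : _ = 0%N) ?addn0.
      rewrite /outdeg big_distrr; apply: eq_bigr => j _.
      by rewrite mulmnE mulnC.
    apply: big1 => j; rewrite inE mnm_sumE => jt; rewrite big1_seq // => a /= at_.
    by rewrite mnm1E; apply/eqP; rewrite eqb0; apply: contraNneq jt => <-.
  (* T contains an end of [p0], so each of the d - 1 copies of that edge counts at most 1. *)
  apply/negP; rewrite -ltnNge -[in ltnRHS](prednK d_gt0) ltnS.
  rewrite outdegD !outdegU !inE.
  by have := t_ps _ p0ps; do 2!case: (_ \in t); rewrite //= ?muln0 ?muln1.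
rewrite mdegMn mdegD !mdeg1 -ps_size => kP.
have /r_max : betti F (size ps).-1 (shift k) != 0%N.
  by rewrite -lt0n card_gt0; apply/set0Pn; exists k; rewrite inE.
have := M_gt0; rewrite -ps_size; lia.
Qed.
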